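(* Let $d \geq 1$, let $\mathcal{C}$ be a $d$-clutter on vertex set $[n]$, let $\mathbb{K}$ be a field and $R = \mathbb{K}[x_1,\dots,x_n]$, and let $e \in \mathcal{C}$ be a circuit. Let $\overline{\mathcal{C}}$ be the complement of $\mathcal{C}$ and $I_{\overline{\mathcal{C}}} \subset R$ its circuit ideal. Then $e$ is an exposed circuit of $\mathcal{C}$ if and only if $\mathbf{x}_e$ is a linear divisor for $I_{\overline{\mathcal{C}}}$. Moreover, for $K \subset [n]$, $K$ is the unique maximal clique of $\mathcal{C}$ containing $e$ if and only if the colon ideal $(I_{\overline{\mathcal{C}}} : \mathbf{x}_e)$ is generated by the variables corresponding to the vertices outside $K$, i.e. $(I_{\overline{\mathcal{C}}} : \mathbf{x}_e) = \langle x_i : i \in [n]\setminus K\rangle$.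
   Context: A $d$-clutter on $[n]=\{1,\dots,n\}$ is a collection $\mathcal{C}$ of $d$-element subsets of $[n]$, called circuits. The complement $\overline{\mathcal{C}}$ is the $d$-clutter on $[n]$ consisting of all $d$-subsets of $[n]$ not in $\mathcal{C}$. A clique ($d$-clique) of $\mathcal{C}$ is a nonempty $S \subset [n]$ such that either $|S|<d$, or $|S|\ge d$ and every $d$-subset of $S$ is a circuit of $\mathcal{C}$; it is maximal if it is maximal under inclusion among cliques. A circuit $e\in\mathcal{C}$ is exposed if it is contained in a unique maximal clique of $\mathcal{C}$. For $e=\{v_1,\dots,v_d\}\subset[n]$, $\mathbf{x}_e = x_{v_1}\cdots x_{v_d}$. The circuit ideal of a $d$-clutter $\mathcal{D}$ is $I_{\mathcal{D}} = \langle \mathbf{x}_f : f\in\mathcal{D}\rangle \subset R$. For a monomial ideal $I\subset R$ and a squarefree monomial $\mathbf{x}_e$ that is not a generator of $I$, $\mathbf{x}_e$ is a linear divisor for $I$ if the colon ideal $(I:\mathbf{x}_e)=\{r\in R : r\mathbf{x}_e\in I\}$ is generated by a (possibly empty) subset of the variables $\{x_1,\dots,x_n\}$. *)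

(* Defs.v *)
From HB Require Import structures.
From mathcomp Require Import all_boot all_order all_algebra.
From mathcomp Require Import mpoly.

Set Implicit Arguments.
Unset Strict Implicit.
Unset Printing Implicit Defensive.

Import GRing.Theory.
Local Open Scope ring_scope.

(* The vertex set [n] is 'I_n; a set of subsets of 'I_n is a clutter only
   under [is_clutter]. *)
Section Clutters.
Variables n d : nat.
Implicit Types (C : {set {set 'I_n}}) (S K e : {set 'I_n}).

Definition is_clutter C : Prop := forall f : {set 'I_n}, f \in C -> #|f| = d.

Definition clutter_compl C : {set {set 'I_n}} :=
  [set f : {set 'I_n} | (#|f| == d) && (f \notin C)].

Definition clique C S : bool :=
  (S != set0) &&
  ((#|S| < d)%N ||
   ((d <= #|S|)%N &&
    [forall f : {set 'I_n}, (f \subset S) && (#|f| == d) ==> (f \in C)])).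

Definition maximal_clique C K : bool := maxset (clique C) K.

Definition unique_maximal_clique C e K : Prop :=
  unique (fun K' => maximal_clique C K' /\ e \subset K') K.

Definition exposed C e : Prop :=
  e \in C /\ exists K, unique_maximal_clique C e K.

End Clutters.

(* Ideals are Prop-valued predicates, compared extensionally. *)
Section Ideals.
Variable A : comNzRingType.
Implicit Types (I J G : A -> Prop).

Definition ideal_gen G : A -> Prop := fun p =>
  exists s : seq (A * A),
    (forall u, u \in s -> G u.2) /\ p = \sum_(u <- s) u.1 * u.2.

Definition colon I (a : A) : A -> Prop := fun r => I (r * a).

Definition ideal_eq I J : Prop := forall r, I r <-> J r.

End Ideals.

Section MonomialIdeals.
Variables (n : nat) (k : fieldType).
Implicit Types (e : {set 'I_n}) (I : {mpoly k[n]} -> Prop).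

Definition xmon e : {mpoly k[n]} := \prod_(i in e) 'X_i.

Definition circuit_ideal (D : {set {set 'I_n}}) : {mpoly k[n]} -> Prop :=
  ideal_gen (fun p => exists2 f, f \in D & p = xmon f).

Definition var_ideal (V : {set 'I_n}) : {mpoly k[n]} -> Prop :=
  ideal_gen (fun p => exists2 i, i \in V & p = 'X_i).

(* x_e belongs to the minimal monomial generating set of the monomial ideal I;
   the proper monomial divisors of x_e are the x_f with f a proper subset. *)
Definition minimal_generator I e : Prop :=
  I (xmon e) /\ forall f : {set 'I_n}, f \proper e -> ~ I (xmon f).

Definition linear_divisor I e : Prop :=
  ~ minimal_generator I e /\
  exists V : {set 'I_n}, ideal_eq (colon I (xmon e)) (var_ideal V).

End MonomialIdeals.

Arguments circuit_ideal {n} k D _.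
Arguments var_ideal {n} k V _.

(* Main.v *)
(** The ideals involved are generated by squarefree monomials, so membership of
    a polynomial is decided monomial by monomial, and only through the support
    [g] of each monomial: [x_g] lies in the colon ideal iff [e :|: g] contains
    a non-circuit, i.e. is not a clique, and [x_g] lies in the ideal of the
    variables outside [K] iff [g] is not included in [K].  Both sides of the
    equivalence thus say that [e :|: g] is a clique exactly when
    [g \subset K]. *)
Require Import Defs.
From mathcomp Require Import all_boot all_order all_algebra.
From mathcomp Require Import mpoly.

Set Implicit Arguments.
Unset Strict Implicit.
Unset Printing Implicit Defensive.

Import GRing.Theory.
Local Open Scope ring_scope.

Section Monomials.
Variables (n : nat) (k : fieldType).
Implicit Types (m : 'X_{1..n}) (f g e : {set 'I_n}) (D : {set {set 'I_n}}).
Implicit Types (p r : {mpoly k[n]}).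

Definition mnm_set f : 'X_{1..n} := [multinom (i \in f : nat) | i < n].

Definition mnm_supp m : {set 'I_n} := [set i | m i != 0%N].

Lemma mnm_supp_set f : mnm_supp (mnm_set f) = f.
Proof. by apply/setP => i; rewrite inE mnmE; case: (i \in f). Qed.

Lemma mnm_suppD m1 m2 : mnm_supp (m1 + m2)%MM = mnm_supp m1 :|: mnm_supp m2.
Proof. by apply/setP => i; rewrite !inE mnmDE addn_eq0 negb_and. Qed.

Lemma mnm_set_le f m : (mnm_set f <= m)%MM = (f \subset mnm_supp m).
Proof.
apply/mnm_lepP/subsetP => [le_fm i fi | sub_fm i].
  by have := le_fm i; rewrite mnmE fi inE lt0n.
rewrite mnmE; case: (boolP (i \in f)) => // /sub_fm.
by rewrite inE lt0n.
Qed.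

Lemma xmonE f : xmon k f = 'X_[mnm_set f].
Proof.
rewrite mpolyXE_id /xmon big_mkcond /=; apply: eq_bigr => i _.
by rewrite mnmE; case: (i \in f).
Qed.

(** Every monomial of a sum of multiples of the [xmon k f] is divisible by one of these generators.
    Conversely, each term of [p] is rewritten as a multiple of a generator dividing it. *)
Lemma circuit_idealP D p :
  circuit_ideal k D p <->
  {in msupp p, forall m, exists2 f, f \in D & f \subset mnm_supp m}.
Proof.
split=> [[s [gen_s ->]] m | mem_p].
  move=> /msupp_sum_le /flattenP[l /mapP[u]].
  rewrite filter_predT => u_s ->.
  have [f fD ->] := gen_s u u_s.
  rewrite xmonE (perm_mem (msuppMX _ _)) => /mapP[m' _ ->].
  by exists f; rewrite // -mnm_set_le lem_addr.
(* [c m] selects one generator dividing the monomial [m]; by [cP] the default [set0] is not reached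
   on the support of [p]. *)
pose c m := odflt set0 [pick f | (f \in D) && (f \subset mnm_supp m)].
have cP m : m \in msupp p -> (c m \in D) && (c m \subset mnm_supp m).
  move=> /mem_p[f fD sub_fm]; rewrite /c; case: pickP => //= /(_ f).
  by rewrite fD sub_fm.
exists [seq (p@_m *: 'X_[m - mnm_set (c m)], xmon k (c m)) | m <- msupp p].
split=> [_ /mapP[m /cP/andP[cD _] ->] | ]; first by exists (c m).
rewrite big_map {1}[p]mpolyE; apply: eq_big_seq => m /cP/andP[_ sub_cm] /=.
by rewrite xmonE -scalerAl -mpolyXD submK // mnm_set_le.
Qed.

(** A variable is the squarefree monomial of a singleton, so the membership criterion for circuit
    ideals also covers ideals of variables. *)
Lemma var_idealE V p :
  var_ideal k V p <-> circuit_ideal k [set [set i] | i in V] p.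
Proof.
have xmon1 i : xmon k [set i] = 'X_i by rewrite /xmon big_set1.
split=> -[s [gen_s ->]]; exists s; split=> // u /gen_s.
  by case=> i iV ->; exists [set i]; rewrite ?xmon1 // imset_f.
by case=> f /imsetP[i iV ->] ->; exists i; rewrite ?xmon1.
Qed.

Lemma var_idealP V p :
  var_ideal k (~: V) p <->
  {in msupp p, forall m, ~~ (mnm_supp m \subset V)}.
Proof.
rewrite var_idealE circuit_idealP; split=> mem_p m /mem_p.
  case=> f /imsetP[i]; rewrite inE => iV ->; rewrite sub1set => im.
  by apply/subsetPn; exists i.
case/subsetPn=> i im iV; exists [set i]; last by rewrite sub1set.
by rewrite imset_f // inE.
Qed.

(** Multiplying by a monomial shifts exponents injectively, so nothing cancels: the monomials of
    [r * xmon k e] have supports [e :|: mnm_supp m]. *)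
Lemma colon_circuit_idealP D e r :
  colon (circuit_ideal k D) (xmon k e) r <->
  {in msupp r, forall m, exists2 f, f \in D & f \subset e :|: mnm_supp m}.
Proof.
rewrite /colon circuit_idealP xmonE; split=> mem_r m.
  move=> mr; have := mem_r (mnm_set e + m)%MM.
  rewrite mnm_suppD mnm_supp_set; apply.
  by rewrite (perm_mem (msuppMX _ _)) map_f.
rewrite (perm_mem (msuppMX _ _)) => /mapP[m' /mem_r m'r ->].
by rewrite mnm_suppD mnm_supp_set.
Qed.

Lemma colon_eq_var_ideal D e K :
  ideal_eq (colon (circuit_ideal k D) (xmon k e)) (var_ideal k (~: K)) <->
  forall g, (exists2 f, f \in D & f \subset e :|: g) <-> ~~ (g \subset K).
Proof.
split=> [eq_col g | eq_col r].
  (* The squarefree monomial with support [g] serves as the test element. *)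
  have := eq_col 'X_[mnm_set g]; rewrite colon_circuit_idealP var_idealP.
  have suppg : mnm_set g \in msupp ('X_[mnm_set g] : {mpoly k[n]}).
    by rewrite msuppX mem_head.
  move=> [colK Kcol]; split=> [De | gK].
    have := colK _ _ suppg; rewrite mnm_supp_set; apply=> m.
    by rewrite msuppX inE => /eqP ->; rewrite mnm_supp_set.
  have := Kcol _ _ suppg; rewrite mnm_supp_set; apply=> m.
  by rewrite msuppX inE => /eqP ->; rewrite mnm_supp_set.
by rewrite colon_circuit_idealP var_idealP; split=> mem_r m /mem_r /eq_col.
Qed.

End Monomials.

Section Cliques.
Variables (n d : nat) (C : {set {set 'I_n}}).
Implicit Types (e f g K S T : {set 'I_n}).

Lemma clique_sub S T : S != set0 -> S \subset T -> clique d C T -> clique d C S.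
Proof.
move=> S0 sST /andP[_ clT]; rewrite /clique S0 /=.
case: ltnP => //= dS; have dT := leq_trans dS (subset_leq_card sST).
move: clT; rewrite ltnNge dT /= => /forall_inP clT.
apply/forall_inP => f /andP[fS fd]; apply: clT.
by rewrite (subset_trans fS sST).
Qed.

(** The bounds on [d] make [S] nonempty and exclude sets that are cliques merely by being small. *)
Lemma cliquePn S : (0 < d <= #|S|)%N ->
  (exists2 f, f \in clutter_compl d C & f \subset S) <-> ~~ clique d C S.
Proof.
move=> /andP[d0 dS]; rewrite /clique -card_gt0 (leq_trans d0 dS) ltnNge dS /=.
split=> [[f fC fS] | /forall_inPn[f /andP[fS fd] fC]].
  move: fC; rewrite inE => /andP[fd fC]; apply/forall_inPn; exists f => //.
  by apply/andP.
by exists f; rewrite // inE fd.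
Qed.

(** Any clique [e :|: g] extends to a maximal clique containing [e], which uniqueness identifies
    with [K]. Conversely, the choices [g := e] and [g := K] show that [K] contains [e] and is a
    clique. *)
Lemma unique_maximal_cliqueP e K : e != set0 -> clique d C e ->
  unique_maximal_clique d C e K <->
  forall g, clique d C (e :|: g) = (g \subset K).
Proof.
move=> e0 cle; have eU0 g : e :|: g != set0 by rewrite setU_eq0 negb_and e0.
split=> [[[maxK eK] uniqK] g | clE].
  apply/idP/idP=> [clg | gK].
    have [L maxL sgL] := maxset_exists clg.
    have /uniqK -> : maximal_clique d C L /\ e \subset L.
      by split=> //; apply: subset_trans sgL; apply: subsetUl.
    by apply: subset_trans sgL; apply: subsetUr.
  by apply: clique_sub (maxsetp maxK); rewrite // subUset eK.
have eK : e \subset K by rewrite -clE setUid.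
have clK : clique d C K by rewrite -(setUidPr eK) clE.
have sub_clique S : clique d C S -> e \subset S -> S \subset K.
  by move=> clS eS; rewrite -clE (setUidPr eS).
split=> [|S [maxS eS]].
  split=> //; apply/maxsetP; split=> // S clS KS.
  by apply/eqP; rewrite eqEsubset KS sub_clique ?(subset_trans eK).
by apply: (maxsetsup maxS clK); apply: sub_clique (maxsetp maxS) eS.
Qed.

Lemma circuit_clique e : (0 < d)%N -> #|e| = d -> e \in C -> clique d C e.
Proof.
move=> d0 ed eC; rewrite /clique -card_gt0 ed d0 leqnn ltnn /=.
apply/forall_inP => f /andP[fe /eqP fd].
by have /eqP -> : f == e by rewrite eqEcard fe ed fd leqnn.
Qed.

End Cliques.

(** A non-circuit of size [d] inside [e] would have to equal [e]. Hence [xmon k e] is not a minimal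
    generator. *)
Lemma xmon_notin_circuit_ideal (n d : nat) (k : fieldType)
    (C : {set {set 'I_n}}) (e : {set 'I_n}) :
  #|e| = d -> e \in C -> ~ circuit_ideal k (clutter_compl d C) (xmon k e).
Proof.
move=> ed eC /circuit_idealP/(_ (mnm_set e)).
rewrite xmonE msuppX mem_head => /(_ isT)[f].
rewrite inE mnm_supp_set => /andP[/eqP fd fC] fe.
have /eqP fE : f == e by rewrite eqEcard fe ed fd leqnn.
by rewrite fE eC in fC.
Qed.

Lemma unique_maximal_clique_colon (n d : nat) (k : fieldType)
    (C : {set {set 'I_n}}) (e K : {set 'I_n}) :
  (0 < d)%N -> #|e| = d -> e \in C ->
  unique_maximal_clique d C e K <->
  ideal_eq (colon (circuit_ideal k (clutter_compl d C)) (xmon k e))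
           (var_ideal k (~: K)).
Proof.
move=> d0 ed eC; rewrite colon_eq_var_ideal unique_maximal_cliqueP; first last.
- exact: circuit_clique.
- by rewrite -card_gt0 ed.
(* Containing [e] forces at least [d] elements, as [cliquePn] requires. *)
have dU g : (0 < d <= #|e :|: g|)%N.
  by rewrite d0 -{1}ed subset_leq_card // subsetUl.
split=> [clE g | colE g]; first by rewrite cliquePn // clE.
have := colE g; rewrite cliquePn // => -[clK Kcl].
by apply/idP/idP; apply: contraTT.
Qed.

Theorem theorem3p1 (n d : nat) (hd : (1 <= d)%N) (k : fieldType)
    (C : {set {set 'I_n}}) (hC : is_clutter d C)
    (e : {set 'I_n}) (he : e \in C) :
  (exposed d C e <-> linear_divisor (circuit_ideal k (clutter_compl d C)) e)
  /\ (forall K : {set 'I_n},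
        unique_maximal_clique d C e K <->
        ideal_eq (colon (circuit_ideal k (clutter_compl d C)) (xmon k e))
                 (var_ideal k (~: K))).
Proof.
have ed := hC e he.
have cliqueE K := unique_maximal_clique_colon k K hd ed he.
split=> //; split=> [[_ [K /cliqueE colK]] | [_ [V colV]]].
  split; last by exists (~: K).
  by case=> /(xmon_notin_circuit_ideal ed he).
(* The clique consists of the vertices whose variables do not generate the colon ideal. *)
by split=> //; exists (~: V); apply/cliqueE; rewrite setCK.
Qed.
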